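(* Let $Y$ be a real vector space. Suppose that $C\subset Y$ is a non-trivial algebraically closed convex pointed cone with $k\in\operatorname{core}C$, and let $a\in Y$. Denote by $\|\cdot\|_{C,k}$ the norm that is given as the Minkowski functional of the order interval $[-k,k]_C$. Then $$\|y-a\|_{C,k}=\varphi_{a-C,k}(y)\quad\text{for all } y\in a+C.$$
   Context: The order interval is $[-k,k]_C=(C-k)\cap(k-C)$, and its Minkowski functional is $\|y\|_{C,k}=\inf\{\lambda>0\mid y\in\lambda[-k,k]_C\}$; it is a known fact that under the stated assumptions this is a norm on $Y$. For nonempty $A\subseteq Y$ and $k\in Y\setminus\{0\}$, $\varphi_{A,k}(y):=\inf\{t\in\mathbb{R}\mid y\in A+tk\}$ for $y\in Y$, where $\inf\emptyset:=\nu$ with $\nu$ a symbol not in $\mathbb{R}\cup\{-\infty,+\infty\}$, and the infimum is $-\infty$ if the set is unbounded below. Here $A=a-C=\{a-c\mid c\in C\}$. A set $C\subseteq Y$ is a cone iff $\lambda c\in C$ for all $\lambda\in[0,\infty)$, $c\in C$; non-trivial iff $C\ne\emptyset$, $C\ne\{0\}$, $C\ne Y$; pointed iff $C\cap(-C)=\{0\}$; algebraically closed iff for all $c\in C$, $y\in Y$: if $c+\lambda(y-c)\in C$ for all $\lambda\in(0,1)$, then $y\in C$. $\operatorname{core}C$ is the algebraic interior: $c\in\operatorname{core}C$ iff $c\in C$ and for each $v\in Y$ there is $\varepsilon>0$ with $c+sv\in C$ for all $s\in[0,\varepsilon]$. *)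

(* Defs.v *)
From mathcomp Require Import all_boot all_order all_algebra.
From mathcomp Require Import all_classical all_reals all_analysis.

Set Implicit Arguments.
Unset Strict Implicit.
Unset Printing Implicit Defensive.

Import Order.TTheory GRing.Theory Num.Theory.

Local Open Scope classical_set_scope.
Local Open Scope ring_scope.

Section definitions.
Context {R : realType} {Y : lmodType R}.
Implicit Types (A C : set Y) (a k y : Y).

Definition is_cone C : Prop :=
  forall (l : R) (c : Y), 0 <= l -> C c -> C (l *: c).

Definition nontrivial C : Prop :=
  [/\ C <> set0, C <> [set 0] & C <> [set: Y]].

Definition pointed C : Prop :=
  C `&` [set - c | c in C] = [set 0].

Definition algebraically_closed C : Prop :=
  forall c y : Y, C c ->
    (forall l : R, 0 < l -> l < 1 -> C (c + l *: (y - c))) -> C y.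

Definition core C : set Y :=
  [set c | C c /\ forall v : Y, exists2 e : R, 0 < e &
     forall s : R, 0 <= s -> s <= e -> C (c + s *: v)].

Definition order_interval C k : set Y :=
  [set c - k | c in C] `&` [set k - c | c in C].

Definition minkowski_set C k y : set R :=
  [set l | 0 < l /\ [set l *: x | x in order_interval C k] y].

(* [inf] on [R] is 0 on sets without infimum; [minkowski_has_inf] below shows
   that this default never occurs when [k] is in the core of [C]. *)
Definition minkowski_norm C k y : R := inf (minkowski_set C k y).

(* The value [None] is the extra symbol nu = inf(set0), which lies outside of
   the extended reals; [Some r] is the extended real r. *)
Definition phi A k y : option (\bar R) :=
  let S := [set t : R | [set x + t *: k | x in A] y] in
  if `[< S = set0 >] then None else Some (ereal_inf [set t%:E | t in S]).

Lemma minkowski_has_inf C k y :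
  core C k -> has_inf (minkowski_set C k y).
Proof.
move=> [_ coreC]; split; last by exists 0 => l [/ltW].
have [e1 e1_gt0 C1] := coreC y; have [e2 e2_gt0 C2] := coreC (- y).
pose e := Num.min e1 e2.
have e_gt0 : 0 < e by rewrite lt_min e1_gt0.
exists e^-1; split; first by rewrite invr_gt0.
exists (e *: y); last by rewrite scalerA mulVf ?scale1r// gt_eqF.
split.
- exists (k + e *: y); last by rewrite addrC addKr.
  by apply: C1; [exact: ltW | rewrite /e ge_min lexx].
- exists (k + e *: - y); last by rewrite scalerN opprB addrC subrK.
  by apply: C2; [exact: ltW | rewrite /e ge_min lexx orbT].
Qed.

End definitions.

(* Main.v *)
Require Import Defs.
From mathcomp Require Import all_boot all_order all_algebra.
From mathcomp Require Import all_classical all_reals all_analysis.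
From mathcomp Require Import lra.

(** Write [z = y - a], an element of [C].  Both sides are infima of explicit
    sets of reals.  Unfolding the translations, [phi] is the infimum of
      [S = {t | t *: k - z \in C}],
    while the Minkowski functional is the infimum of those [l > 0] for which
    both [l *: k - z] and [l *: k + z] lie in [C].  Since [z] and [k] belong
    to the convex cone [C], the second membership is automatic
    ([minkowski_set_in_cone]), so the Minkowski set is the part of [S] in
    ]0, +oo[.

    Cutting [S] down to ]0, +oo[ does not change its infimum, because [S] is
    closed upwards and contains no negative number ([inf_up_closed_pos]).
    The latter holds because a negative [t] in [S] would give
    [t *: k = (t *: k - z) + z \in C], hence [- k \in C], and [- k] is outside
    of every proper convex cone having [k] in its algebraic interior
    ([opp_core_notin]).  Finally [S] is nonempty and bounded below, so its
    infimum in the extended reals is the real one. *)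

Import Order.TTheory GRing.Theory Num.Theory.

Local Open Scope classical_set_scope.
Local Open Scope ring_scope.

(** A sum is twice a midpoint. *)
Lemma convex_cone_add (R : realType) (Y : lmodType R) (C : set Y) (u v : Y) :
  is_cone C -> convex_set C -> C u -> C v -> C (u + v).
Proof.
move=> C_cone C_convex Cu Cv.
have half_ge0 : 0 <= 2^-1 :> R by lra.
have half_le1 : 2^-1 <= 1 :> R by lra.
have half_onem : 1 - 2^-1 = 2^-1 :> R by lra.
have mid : C (2^-1 *: u + 2^-1 *: v).
  rewrite -[X in _ + X *: _]half_onem; apply/set_mem.
  exact: (C_convex u v (Itv01 half_ge0 half_le1) (mem_set Cu) (mem_set Cv)).
have := C_cone 2 _ (ler0n _ _) mid.
by rewrite scalerDr !scalerA mulfV// !scale1r.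
Qed.

(** If [- k] were in [C], adding it to the points [k + e *: v] of [C] would put
    a positive multiple of every [v] in [C]. *)
Lemma opp_core_notin (R : realType) (Y : lmodType R) (C : set Y) (k : Y) :
  is_cone C -> convex_set C -> C <> [set: Y] -> core C k -> ~ C (- k).
Proof.
move=> C_cone C_convex C_proper [_ k_core] Cnk; apply: C_proper.
apply/seteqP; split=> // v _.
have [e e_gt0 /(_ e (ltW e_gt0) (lexx e)) Cv] := k_core v.
have /(C_cone e^-1) : C (- k + (k + e *: v)) by exact: convex_cone_add.
rewrite addKr scalerA mulVf ?gt_eqF// scale1r; apply.
by rewrite invr_ge0 ltW.
Qed.

Lemma shifted_cone_setE (R : realType) (Y : lmodType R) (C : set Y)
    (k a y : Y) (t : R) :
  [set x + t *: k | x in [set a - c | c in C]] y <-> C (t *: k - (y - a)).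
Proof.
split=> [[_ [c Cc <-] <-]|Cty].
  by rewrite -[a - c + _]addrA addrAC subrr add0r opprD opprK addrCA subrr addr0.
exists (a - (t *: k - (y - a))); first by exists (t *: k - (y - a)).
by rewrite opprB -addrA subrK addrC subrK.
Qed.

(** Of the two inequalities [- l *: k <= z <= l *: k] in the order of [C], the
    left one is automatic when [z] is in [C]. *)
Lemma minkowski_set_in_cone (R : realType) (Y : lmodType R) (C : set Y)
    (k z : Y) :
  is_cone C -> convex_set C -> C k -> C z ->
  minkowski_set C k z = [set l | 0 < l /\ C (l *: k - z)].
Proof.
move=> C_cone C_convex Ck Cz; apply/seteqP; split=> l /= [l_gt0].
  move=> [x [_ [c Cc <-]] <-]; split=> //.
  by rewrite -scalerBr subKr; apply: C_cone => //; exact: ltW.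
move=> Clz; split=> //.
have li_ge0 : 0 <= l^-1 by rewrite invr_ge0 ltW.
have lV : l^-1 * l = 1 by rewrite mulVf ?gt_eqF.
exists (l^-1 *: z); last by rewrite scalerA mulrC lV scale1r.
split.
- exists (k + l^-1 *: z); last by rewrite addrC addKr.
  by apply: convex_cone_add => //; exact: C_cone.
- exists (l^-1 *: (l *: k - z)); first exact: C_cone.
  by rewrite scalerBr scalerA lV scale1r subKr.
Qed.

(** Only the point 0 of [S] can be lost, and then all of ]0, +oo[ remains. *)
Lemma inf_up_closed_pos (R : realType) (S : set R) :
  S !=set0 -> (forall s t, S s -> s <= t -> S t) -> lbound S 0 ->
  inf [set t | 0 < t /\ S t] = inf S.
Proof.
move=> [s0 Ss0] S_up S_ge0; apply/eqP; rewrite eq_le; apply/andP; split.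
- apply: lb_le_inf; first by exists s0.
  move=> s Ss; apply/ler_addgt0Pr => e e_gt0.
  apply: ge_inf; first by exists 0 => t [/ltW].
  split; first by apply: ltr_wpDl => //; exact: S_ge0.
  by apply: S_up Ss _; rewrite lerDl ltW.
- apply: lb_le_inf => [|t [_ St]]; last by apply: ge_inf => //; exists 0.
  exists (s0 + 1); split; first by apply: ltr_wpDl => //; exact: S_ge0.
  by apply: S_up Ss0 _; rewrite lerDl.
Qed.

Theorem proposition11 (R : realType) (Y : lmodType R) (C : set Y) (k a : Y)
    (C_nontrivial : nontrivial C) (C_closed : algebraically_closed C)
    (C_convex : convex_set C) (C_pointed : pointed C) (C_cone : is_cone C)
    (k_core : core C k) (y : Y) (y_in : [set a + c | c in C] y) :
  phi [set a - c | c in C] k y = Some (minkowski_norm C k (y - a))%:E.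
Proof.
have [_ _ C_proper] := C_nontrivial.
have [Ck _] := k_core.
have Cz : C (y - a) by case: y_in => c Cc <-; rewrite addrC addKr.
pose S := [set t : R | C (t *: k - (y - a))].
have S_up s t : S s -> s <= t -> S t.
  move=> Ss st; rewrite /S /= -(subrK s t) scalerDl -addrA.
  apply: convex_cone_add => //.
  by apply: C_cone => //; rewrite subr_ge0.
have S_ge0 : lbound S 0.
  move=> t St; rewrite leNgt; apply/negP => t_lt0.
  apply: (opp_core_notin _ _ _ _ C_cone C_convex C_proper k_core).
  have /(C_cone (- t)^-1) : C (t *: k - (y - a) + (y - a)).
    exact: convex_cone_add.
  rewrite subrK scalerA invrN mulNr mulVf ?lt_eqF// scaleN1r; apply.
  by rewrite -invrN invr_ge0 oppr_ge0 ltW.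
have S_neq0 : S !=set0.
  have [[l]] := minkowski_has_inf (y - a) k_core.
  by rewrite minkowski_set_in_cone// => -[_ Sl] _; exists l.
rewrite /phi; set S' := [set t : R | _].
have -> : S' = S by apply/seteqP; split=> t /shifted_cone_setE.
case: asboolP => [S_eq0|_]; first by move: S_neq0; rewrite S_eq0 => -[].
rewrite ereal_inf_EFin//; last by exists 0.
by rewrite /minkowski_norm minkowski_set_in_cone// (inf_up_closed_pos _ S).
Qed.
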